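(* Let $\bar u_0$ be a solution of $(\mathbb P_0)$. Assume that there is a (measurable) set $A\subset\Omega_U$ with $$\{x\in\Omega_U: B^*\bar p_0(x)=0\}\subset A^c:=\Omega_U\setminus A ,$$ and assume the $\sigma$-condition: there is $\sigma>0$ such that $a(x)\le-\sigma<0<\sigma\le b(x)$ for almost all $x\in\Omega_U$. If $\kappa>1$ and, for some real $p\ge1$ and some constant $C$ independent of $\alpha$, the convergence rates $$\|\bar u_\alpha-\bar u_0\|_{L^p(A)}^p+\|B^*(\bar p_\alpha-\bar p_0)\|_{L^\infty(A)}\le C\alpha^\kappa\qquad\text{for all }\alpha>0$$ hold, then the measure condition holds on $A$ with exponent $\kappa$: there is a constant $C'\ge0$ such that $$\operatorname{meas}(\{x\in A: 0\le|B^*\bar p_0(x)|\le\epsilon\})\le C'\epsilon^\kappa\qquad\text{for all }\epsilon>0 .$$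
   Context: Setting. $\Omega_U\subset\mathbb R^n$, $n\ge1$, is a bounded measurable domain, $U:=L^2(\Omega_U)$ (real-valued), $H$ is an arbitrary (real) Hilbert space, $z\in H$ is fixed, and $T:U\to H$ is linear and continuous, written as $T=SB$ with continuous linear operators $B:U\to R$, $S:R\to H$ for some function space $R$ (always possible, e.g. $B=\mathrm{Id}$, $S=T$). Adjoints are denoted by $^*$, and $U$, $H$ are identified with their duals. Bounds $a,b\in L^\infty(\Omega_U)$ with $a\le b$ are given and $U_{\rm ad}:=\{u\in U: a(x)\le u(x)\le b(x)\text{ for almost all }x\in\Omega_U\}$. For $\alpha\ge0$, problem $(\mathbb P_\alpha)$ is $\min_{u\in U_{\rm ad}}\ \frac12\|Tu-z\|_H^2+\frac\alpha2\|u\|_U^2$. It has at least one solution $\bar u_\alpha$, which is unique if $\alpha>0$. Put $\bar y_\alpha:=T\bar u_\alpha$ and $\bar p_\alpha:=S^*(\bar y_\alpha-z)$, so that $B^*\bar p_\alpha=T^*(T\bar u_\alpha-z)\in U$; $\bar y_\alpha$ and $\bar p_\alpha$ are unique for every $\alpha\ge0$, even if $\bar u_0$ is not. *)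

(* Defs.v *)
From HB Require Import structures.
From mathcomp Require Import all_boot all_order all_algebra sesquilinear.
From mathcomp Require Import all_classical all_reals all_analysis.
From mathcomp Require Import measurable_realfun ess_sup_inf.

Set Implicit Arguments.
Unset Strict Implicit.
Unset Printing Implicit Defensive.
Import Order.TTheory GRing.Theory Num.Theory.
Import numFieldNormedType.Exports.

Local Open Scope classical_set_scope.
Local Open Scope ring_scope.

(* Lebesgue measure on R^n is the Caratheodory restriction of the outer measure
   obtained from countable covers by compact boxes. *)
Section lebesgue_Rn.
Context (R : realType) (n : nat).
Local Open Scope ereal_scope.
Implicit Types (I : 'rV[R]_n * 'rV[R]_n) (X : set 'rV[R]_n).

(* the box with lower corner I.1 and upper corner I.2; when some
   I.2 i < I.1 i it is empty and has volume 0 *)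
Definition box I : set 'rV[R]_n :=
  [set x | forall i, (I.1 ord0 i <= x ord0 i <= I.2 ord0 i)%R].

Definition box_volume I : R :=
  (\prod_(i < n) Num.max 0 (I.2 ord0 i - I.1 ord0 i))%R.

Lemma box_volume_ge0 I : 0 <= (box_volume I)%:E.
Proof.
by rewrite lee_fin; apply: prodr_ge0 => i _; rewrite le_max lexx.
Qed.

Definition box_covers X : set (set ('rV[R]_n * 'rV[R]_n)) :=
  [set C | countable C /\ X `<=` \bigcup_(I in C) box I].

Definition lebesgue_outer X : \bar R :=
  ereal_inf [set \esum_(I in C) (box_volume I)%:E | C in box_covers X].

Let esum_ge0' C : 0 <= \esum_(I in C) (box_volume I)%:E.
Proof. by apply: esum_ge0 => I _; exact: box_volume_ge0. Qed.

Let lebesgue_outer0 : lebesgue_outer set0 = 0.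
Proof.
apply/eqP; rewrite eq_le; apply/andP; split.
  by apply: ereal_inf_lbound; exists set0; [split|rewrite esum_set0].
by apply: le_ereal_inf_tmp => _ [C _ <-].
Qed.

Let lebesgue_outer_ge0 X : 0 <= lebesgue_outer X.
Proof. by apply: le_ereal_inf_tmp => _ [C _ <-]. Qed.

Let le_lebesgue_outer : {homo lebesgue_outer : X Y / X `<=` Y >-> X <= Y}.
Proof.
move=> X Y XY; apply/ereal_inf_le_tmp => _ [C [cC YC] <-].
by exists C => //; split => //; exact: subset_trans YC.
Qed.

Let lebesgue_outer_sigma_subadditive : sigma_subadditive lebesgue_outer.
Proof.
move=> F; have [[i ioo]|] := pselect (exists i, lebesgue_outer (F i) = +oo).
  rewrite (eseries_pinfty _ _ ioo) ?leey// => k _.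
  by rewrite gt_eqF// (lt_le_trans _ (lebesgue_outer_ge0 _)).
rewrite -forallNE => Foo; apply/lee_addgt0Pr => _/posnumP[e].
rewrite (le_trans _ (epsilon_trick _ _ _))//.
have /choice[G PG] k : exists C, box_covers (F k) C /\
    \esum_(I in C) (box_volume I)%:E <=
    lebesgue_outer (F k) + (e%:num / (2 ^ k.+1)%:R)%:E.
  have ffin : lebesgue_outer (F k) \is a fin_num.
    by rewrite ge0_fin_numE// ltey; apply/eqP; exact: Foo.
  have ek : (0 < e%:num / (2 ^ k.+1)%:R)%R by [].
  have [_ [C CF <-] /ltW le] := lb_ereal_inf_adherent ek ffin.
  by exists C.
apply: (@le_trans _ _ (\esum_(I in \bigcup_k G k) (box_volume I)%:E)).
  apply: ereal_inf_lbound; exists (\bigcup_k G k) => //; split.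
    by apply: bigcup_countable => // k _; exact: (PG k).1.1.
  move=> x [k _ /(PG k).1.2[I GI xI]]; exists I => //; by exists k.
rewrite seqDU_bigcup_eq (esum_bigcupT _ _ (@trivIset_seqDU _ G) box_volume_ge0).
rewrite -nneseries_esumT; last by move=> k; exact: esum_ge0'.
apply: lee_nneseries => [k _ _|k _]; first exact: esum_ge0'.
apply: le_trans (PG k).2.
rewrite esum_mkcond [leRHS]esum_mkcond; apply: le_esum => I _.
have [/set_mem GI|_] := boolP (I \in seqDU G k).
  by rewrite mem_set//; exact: subset_seqDU GI.
by case: ifPn => // _; exact: box_volume_ge0.
Qed.

HB.instance Definition _ := isOuterMeasure.Build R 'rV[R]_n lebesgue_outer
  lebesgue_outer0 lebesgue_outer_ge0 le_lebesgue_outer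
  lebesgue_outer_sigma_subadditive.

(* a copy of 'rV[R]_n whose measurable sets are the Lebesgue-measurable ones *)
Definition Rn := caratheodory_type lebesgue_outer.
HB.instance Definition _ := Measurable.on Rn.

Definition lebesgue_Rn : set Rn -> \bar R := lebesgue_outer.
HB.instance Definition _ := isMeasure.Build _ Rn R lebesgue_Rn
  (caratheodory_measure0 lebesgue_outer)
  (@caratheodory_measure_ge0 R _ lebesgue_outer)
  (@caratheodory_measure_sigma_additive R _ lebesgue_outer).

End lebesgue_Rn.
Arguments lebesgue_Rn : clear implicits.

Notation lebesgue_on mD := (mrestr (lebesgue_Rn _ _) mD).
Notation L2 mD := (LspaceType2 (lebesgue_on mD)).
Notation Linfty mD := (LspaceType (lebesgue_on mD) (leey 1)).

(* The library's LspaceType is the bare quotient modulo a.e. equality; here it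
   receives its vector space structure and the norm fine 'N[mu]_p[f]. *)
Section Lspace_normed.
Context d (X : measurableType d) (R : realType).
Variables (mu : {measure set X -> \bar R}) (p : \bar R) (p1 : (1 <= p)%E).
Local Notation Lp := (LspaceType mu p1).
Local Notation Lf := (LfunType mu p1).
Implicit Types (f g h : Lp).
Local Open Scope quotient_scope.

(* LspaceType coerces to functions into measurableTypeR R, a copy of R without
   ring structure; Lspace_fun f is the same representative, with values in R. *)
Definition Lspace_fun (f : Lp) : X -> R := f.

Let rep_subproof (f : Lp) : Lspace_fun f \in Lfun mu p.
Proof.
rewrite inE; apply/andP; split; rewrite inE/=.
  exact: (@measurable_funPT _ _ _ _
    (repr (f : {mfun_ mu, X >-> measurableTypeR R}))).
exact: (@Lebesgue_finite _ _ _ _ _ p1 f).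
Qed.
Definition Lspace_rep (f : Lp) : Lf := Lfun_Sub p1 (rep_subproof f).

Let Lfun_mfun (u : Lf) : {mfun X >-> measurableTypeR R} :=
  HB.pack (u : X -> measurableTypeR R)
    (isMeasurableFun.Build _ _ _ _ (u : X -> measurableTypeR R)
      (@measurable_funPT _ _ _ _ (u : {mfun X >-> R}))).

Let class_mfun (u : Lf) : {mfun_ mu, X >-> measurableTypeR R} :=
  \pi_({mfun_ mu, X >-> measurableTypeR R}) (Lfun_mfun u).

Let class_mfunE (u : Lf) : (class_mfun u : X -> R) = u %[ae mu].
Proof.
have /eqP := reprK (class_mfun u).
by rewrite /class_mfun eqmodE => /asboolP.
Qed.

Lemma ae_eq_Lnorm (u v : X -> R) : measurable_fun setT u ->
  measurable_fun setT v -> u = v %[ae mu] ->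
  ('N[mu]_p[EFin \o u] = 'N[mu]_p[EFin \o v])%E.
Proof.
move=> mu_ mv uv; rewrite unlock; case: p p1 => [r r1| _|//].
- congr (_ `^ _)%E; apply: ae_eq_integral => //.
  + apply/measurable_EFinP.
    by apply: (measurableT_comp (measurable_powR _)); exact: measurableT_comp.
  + apply/measurable_EFinP.
    by apply: (measurableT_comp (measurable_powR _)); exact: measurableT_comp.
  + by apply: filterS uv => x /(_ I) uvx _ /=; rewrite uvx.
- case: ifPn => // _; apply: eq_ess_sup.
  by apply: filterS uv => x /(_ I) uvx /=; rewrite uvx.
Qed.

Let class_finite (u : Lf) : finite_norm mu p (class_mfun u).
Proof.
rewrite /finite_norm (_ : Lnorm _ _ _ = 'N[mu]_p[EFin \o u])%E.
  exact: Lfunction_finite.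
apply: (@ae_eq_Lnorm (class_mfun u));
  [|exact: measurable_funPT|exact: class_mfunE].
exact: (@measurable_funPT _ _ _ _ (repr (class_mfun u))).
Qed.

HB.instance Definition _ u :=
  isFinLebesgue.Build _ _ _ mu p p1 (class_mfun u) (class_finite u).

Definition Lspace_class (u : Lf) : Lp := class_mfun u.

Lemma Lspace_classK (u : Lf) : Lspace_fun (Lspace_class u) = u %[ae mu].
Proof. exact: class_mfunE. Qed.

Lemma Lspace_eqP (f g : Lp) :
  f = g <-> Lspace_fun f = Lspace_fun g %[ae mu].
Proof.
split=> [->|fg]; first exact: ae_eq_refl.
have : (f : {mfun_ mu, X >-> measurableTypeR R}) = g.
  rewrite -[LHS]reprK -[RHS]reprK; apply/eqP; rewrite eqmodE; exact/asboolP.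
case: f g {fg} => f [[f1]] [g [[g1]]] /= fg; subst g.
by rewrite (Prop_irrelevance f1 g1).
Qed.

HB.instance Definition _ := gen_eqMixin Lp.
HB.instance Definition _ := gen_choiceMixin Lp.

Let zero : Lp := Lspace_class 0.
Let opp (f : Lp) : Lp := Lspace_class (- Lspace_rep f).
Let add (f g : Lp) : Lp := Lspace_class (Lspace_rep f + Lspace_rep g).
Let scale (c : R) (f : Lp) : Lp := Lspace_class (c *: Lspace_rep f).

Let ae_filter : Filter (nbhs (almost_everywhere mu)) :=
  ae_filter_ringOfSetsType mu.

Let addE f g :
  Lspace_fun (add f g) = Lspace_fun f \+ Lspace_fun g %[ae mu].
Proof. exact: Lspace_classK. Qed.
Let oppE f : Lspace_fun (opp f) = \- Lspace_fun f %[ae mu].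
Proof. exact: Lspace_classK. Qed.
Let zeroE : Lspace_fun zero = cst 0 %[ae mu].
Proof. exact: Lspace_classK. Qed.
Let scaleE c f :
  Lspace_fun (scale c f) = (fun x => c * Lspace_fun f x) %[ae mu].
Proof. exact: Lspace_classK. Qed.

Let addA : associative add.
Proof.
move=> f g h; apply/Lspace_eqP.
have H1 := @filterI _ _ ae_filter _ _ (addE f (add g h)) (addE g h).
have H2 := @filterI _ _ ae_filter _ _ (addE (add f g) h) (addE f g).
apply: filterS2 H1 H2 => x [/(_ I)-> /(_ I)/=->] [/(_ I)-> /(_ I)/=->] _ /=.
by rewrite addrA.
Qed.
Let addC : commutative add.
Proof. by move=> f g; rewrite /add addrC. Qed.
Let add0 : left_id zero add.
Proof.
move=> f; apply/Lspace_eqP; apply: filterS2 (addE zero f) zeroE.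
by move=> x /(_ I)-> /(_ I)/=-> _; rewrite add0r.
Qed.
Let addN : left_inverse zero opp add.
Proof.
move=> f; apply/Lspace_eqP; apply: filterS3 (addE (opp f) f) (oppE f) zeroE.
by move=> x /(_ I)-> /(_ I)/=-> /(_ I)-> _; rewrite addNr.
Qed.
HB.instance Definition _ := GRing.isZmodule.Build Lp addA addC add0 addN.

Let scaleA a b f : scale a (scale b f) = scale (a * b) f.
Proof.
apply/Lspace_eqP.
apply: filterS3 (scaleE a (scale b f)) (scaleE b f) (scaleE (a * b) f).
by move=> x /(_ I)-> /(_ I)/=-> /(_ I)-> _; rewrite mulrA.
Qed.
Let scale1 : left_id 1 scale.
Proof.
move=> f; apply/Lspace_eqP; apply: filterS (scaleE 1 f).
by move=> x /(_ I)-> _; rewrite mul1r.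
Qed.
Let scaleDr : right_distributive scale +%R.
Proof.
move=> a f g; apply/Lspace_eqP.
have H1 := @filterI _ _ ae_filter _ _ (scaleE a (add f g)) (addE f g).
have H2 := @filterI _ _ ae_filter _ _ (scaleE a f) (scaleE a g).
apply: filterS3 H1 H2 (addE (scale a f) (scale a g)) => x.
move=> [/(_ I) afg /(_ I) fg] [/(_ I) af /(_ I) ag] /(_ I) H _.
by rewrite afg H fg /= af ag mulrDr.
Qed.
Let scaleDl f : {morph scale^~ f : a b / a + b}.
Proof.
move=> a b; apply/Lspace_eqP.
have H1 := @filterI _ _ ae_filter _ _ (scaleE a f) (scaleE b f).
apply: filterS3 H1 (scaleE (a + b) f) (addE (scale a f) (scale b f)) => x.
move=> [/(_ I) af /(_ I) bf] /(_ I) abf /(_ I) H _.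
by rewrite abf H /= af bf mulrDl.
Qed.
HB.instance Definition _ := GRing.Zmodule_isLmodule.Build R Lp
  scaleA scale1 scaleDr scaleDl.

Lemma LspaceD f g :
  Lspace_fun (f + g) = Lspace_fun f \+ Lspace_fun g %[ae mu].
Proof. exact: addE. Qed.

Lemma LspaceN f : Lspace_fun (- f) = \- Lspace_fun f %[ae mu].
Proof. exact: oppE. Qed.

Lemma LspaceZ (c : R) f :
  Lspace_fun (c *: f) = (fun x => c * Lspace_fun f x) %[ae mu].
Proof. exact: scaleE. Qed.

Lemma Lspace0 : Lspace_fun 0 = cst 0 %[ae mu].
Proof. exact: zeroE. Qed.

Definition Lspace_norm (f : Lp) : R := fine 'N[mu]_p[EFin \o Lspace_fun f]%E.

Let Lspace_norm_class u :
  Lspace_norm (Lspace_class u) = fine 'N[mu]_p[EFin \o u]%E.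
Proof.
rewrite /Lspace_norm; congr fine; apply: ae_eq_Lnorm.
- exact: (@measurable_funPT _ _ _ _ (Lspace_rep (Lspace_class u))).
- exact: measurable_funPT.
- exact: Lspace_classK.
Qed.

Let ler_Lspace_normD f g : Lspace_norm (f + g) <= Lspace_norm f + Lspace_norm g.
Proof. by rewrite Lspace_norm_class; exact: ler_LnormD. Qed.

Let Lspace_normZ (c : R) f : Lspace_norm (c *: f) = `|c| * Lspace_norm f.
Proof.
rewrite Lspace_norm_class.
have /(congr1 fine) := LnormZ (Lspace_rep f) c.
by rewrite -finite_norm_fine.
Qed.

Let Lspace_norm_eq0 f : Lspace_norm f = 0 -> f = 0.
Proof.
move=> /(@fine_Lnormr_eq0 _ _ _ mu _ p1 (Lspace_rep f)) f0.
apply/Lspace_eqP; apply: filterS2 f0 Lspace0 => x /(_ I) f0 /(_ I) -> _.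
exact: f0.
Qed.

HB.instance Definition _ := Lmodule_isNormed.Build R Lp
  ler_Lspace_normD Lspace_normZ Lspace_norm_eq0.

End Lspace_normed.

Section L2_inner.
Context d (X : measurableType d) (R : realType).
Variable mu : {measure set X -> \bar R}.
Implicit Types u v : LspaceType2 mu.

Definition L2_inner u v : R := \int[mu]_x (Lspace_fun u x * Lspace_fun v x).

Lemma L2_inner_norm u : L2_inner u u = `|u| ^+ 2.
Proof.
rewrite /L2_inner /Rintegral.
rewrite -[`|u|]/(fine 'N[mu]_2%:E[EFin \o Lspace_fun u]%E).
have N2fin : 'N[mu]_2%:E[EFin \o Lspace_fun u]%E \is a fin_num.
  rewrite ge0_fin_numE ?Lnorm_ge0//.
  exact: (@Lfunction_finite _ _ _ _ _ (lee1n 2) (Lspace_rep u)).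
rewrite -powR_mulrn ?fine_ge0 ?Lnorm_ge0// -fine_poweR// poweR_Lnorm//.
congr fine; apply: eq_integral => x _ /=.
by rewrite powR_mulrn// -normrX ger0_norm ?sqr_ge0// expr2.
Qed.

End L2_inner.

Section adjoints.
Context (R : realType).

(* S^* : H -> V', the Hilbert space H being identified with its dual through
   the inner product: S^* h is the functional v |-> (S v, h)_H *)
Definition dual_adjoint (H : lmodType R) (inner : H -> H -> R) (V : Type)
    (S : V -> H) (h : H) : V -> R^o := fun v => inner (S v) h.

(* Bstar represents B^* : V' -> U, with U = L^2(mu) identified with its dual:
   (B^* phi, u)_U = phi (B u) for phi in the topological dual V'. The values of
   Bstar outside V' are irrelevant. *)
Definition is_L2_adjoint d (X : measurableType d)
    (mu : {measure set X -> \bar R}) (V : topologicalLmodType R)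
    (B : LspaceType2 mu -> V) (Bstar : (V -> R^o) -> LspaceType2 mu) : Prop :=
  forall phi : {linear V -> R^o}, continuous phi ->
  forall u, L2_inner (Bstar phi) u = phi (B u).

End adjoints.

Section control_problem.
Context d (X : measurableType d) (R : realType).
Variable mu : {measure set X -> \bar R}.
Variables (H : normedModType R) (T : LspaceType2 mu -> H) (z : H).
Variables (a b : LspaceType mu (leey 1)).
Implicit Types u v : LspaceType2 mu.

Definition U_ad : set (LspaceType2 mu) := [set u |
  \forall x \ae mu, Lspace_fun a x <= Lspace_fun u x <= Lspace_fun b x].

Definition cost (alpha : R) u : R :=
  2^-1 * `|T u - z| ^+ 2 + alpha / 2 * `|u| ^+ 2.

Definition is_solution (alpha : R) u : Prop :=
  U_ad u /\ forall v, U_ad v -> cost alpha u <= cost alpha v.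

End control_problem.

(* Main.v *)
(* Testing the variational inequality of (P_alpha) with a single function shows
   that, a.e., u_alpha = a where B^*p_alpha + alpha u_alpha > 0 and u_alpha = b
   where it is < 0.  For alpha = 0 and on A this gives |u_0| >= sigma.  Where
   |B^*p_0| <= alpha sigma/4, the rate of the adjoint states and kappa > 1 give
   |B^*p_alpha| <= alpha sigma/2 for small alpha, hence |u_alpha| <= sigma/2.
   So |u_alpha - u_0| >= sigma/2 there, and the L^p rate with
   alpha = 4 eps/sigma bounds the measure of that set by a multiple of
   eps^kappa.  Large eps are absorbed by the finite measure of Omega. *)
Require Import Defs.
From HB Require Import structures.
From mathcomp Require Import all_boot all_order all_algebra sesquilinear.
From mathcomp Require Import all_classical all_reals all_analysis.
From mathcomp Require Import measurable_realfun ess_sup_inf ring lra.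
Import Order.TTheory GRing.Theory Num.Theory.
Import numFieldNormedType.Exports.
Local Open Scope classical_set_scope.
Local Open Scope ring_scope.

(** * Integrals and almost-everywhere statements on a measure space *)

Section integration.
Context {d : measure_display} {X : measurableType d} {R : realType}.
Context {mu : {measure set X -> \bar R}}.

Lemma Lfun_measurable (p : \bar R) (f : X -> R) :
  f \in Lfun mu p -> measurable_fun setT f.
Proof. by rewrite inE => /andP[]; rewrite inE. Qed.

Lemma Lfun_le (r : R) (f g : X -> R) : 0 < r -> measurable_fun setT g ->
  (forall x, `|g x| <= `|f x|) -> f \in Lfun mu r%:E -> g \in Lfun mu r%:E.
Proof.
move=> r0 mg gf fL; have mf := Lfun_measurable _ _ fL.
have mpow (h : X -> R) : measurable_fun setT h ->
    measurable_fun setT (fun x => (`|h x| `^ r)%:E).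
  move=> mh; apply/measurable_EFinP.
  by apply: (measurableT_comp (measurable_powR _)); exact: measurableT_comp.
rewrite inE; apply/andP; split; first by rewrite inE.
rewrite inE /finite_norm/=; move: fL; rewrite inE => /andP[_].
rewrite inE /finite_norm/= unlock; apply: le_lt_trans.
have int_ge0 (h : X -> R) : (0 <= \int[mu]_x (`|h x| `^ r)%:E)%E.
  by apply: integral_ge0 => x _; rewrite lee_fin powR_ge0.
apply: gt0_ler_poweR.
- by rewrite invr_ge0 ltW.
- by rewrite in_itv/= leey andbT; exact: int_ge0.
- by rewrite in_itv/= leey andbT; exact: int_ge0.
- apply: ge0_le_integral => //; [|exact: mpow|exact: mpow|] => x _.
    by rewrite poweR_ge0.
  by rewrite /= lee_fin ge0_ler_powR ?nnegrE// ltW.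
Qed.

Lemma Lfun_indicM (r : R) (E : set X) (f : X -> R) : 0 < r -> measurable E ->
  f \in Lfun mu r%:E -> (fun x => \1_E x * f x) \in Lfun mu r%:E.
Proof.
move=> r0 mE fL; apply: (Lfun_le r f) => // [|x].
  apply: measurable_funM; first exact: measurable_indic.
  exact: (Lfun_measurable _ _ fL).
rewrite normrM indicE.
by case: (_ \in _); rewrite ?normr1 ?mul1r// normr0 mul0r.
Qed.

(** For [g <= 0] the integral of [|g|] is minus that of [g], hence zero under the last
    hypothesis. *)
Lemma ae_eq0_le0_Rintegral (g : X -> R) : mu.-integrable setT (EFin \o g) ->
  (\forall x \ae mu, g x <= 0) -> 0 <= \int[mu]_x g x ->
  \forall x \ae mu, g x = 0.
Proof.
move=> ig g0 intg; have mg := measurable_int _ ig.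
have gN : (\int[mu]_x `|(EFin \o g) x| = - \int[mu]_x (EFin \o g) x)%E.
  rewrite -integralN; last exact: integrable_add_def.
  apply: ae_eq_integral => //; [exact: measurableT_comp..|].
  by apply: filterS g0 => x gx _ /=; rewrite ler0_norm// EFinN.
have : (\int[mu]_x `|(EFin \o g) x| = 0)%E.
  apply/eqP; rewrite eq_le integral_ge0// andbT gN leeNl oppe0.
  by rewrite -[leRHS]fineK ?lee_fin//; exact: integrable_fin_num.
move/(ae_eq_integral_abs mu measurableT mg).
by apply: filterS => x /(_ I) [].
Qed.

Lemma ae_and (P Q : X -> Prop) : (\forall x \ae mu, P x) ->
  (\forall x \ae mu, Q x) -> \forall x \ae mu, P x /\ Q x.
Proof. exact: filterI. Qed.

Lemma Linfty_norm_ae_le (f : X -> \bar R) (M : \bar R) :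
  ('N[mu]_+oo[f] <= M)%E -> \forall x \ae mu, (`|f x| <= M)%E.
Proof.
(* The norm is 0 by convention on a space of measure zero; there the whole space serves as the
   exceptional null set. *)
rewrite unlock; case: ifPn => [_ /ess_supP//|]; rewrite -leNgt => mu0 _.
exists setT; split => //.
by apply/eqP; rewrite eq_le mu0 measure_ge0.
Qed.

End integration.

(** * The inner product of [L2], computed through representatives *)

Section L2.
Context {d : measure_display} {X : measurableType d} {R : realType}.
Context {mu : {measure set X -> \bar R}}.
Implicit Types (u v w : LspaceType2 mu).

Lemma Lspace_fun_Lfun (p : \bar R) (p1 : (1 <= p)%E) (f : LspaceType mu p1) :
  Lspace_fun f \in Lfun mu p.
Proof. exact: (LfunP (Lspace_rep f)). Qed.

Lemma measurable_Lspace_fun (p : \bar R) (p1 : (1 <= p)%E)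
  (f : LspaceType mu p1) : measurable_fun setT (Lspace_fun f).
Proof. exact: (Lfun_measurable _ _ (Lspace_fun_Lfun _ _ f)). Qed.

Lemma Lspace_of_Lfun (p : \bar R) (p1 : (1 <= p)%E) (f : X -> R) :
  f \in Lfun mu p ->
  exists g : LspaceType mu p1, \forall x \ae mu, Lspace_fun g x = f x.
Proof.
move=> fL; exists (Lspace_class (Lfun_Sub p1 fL)).
by apply: filterS (Lspace_classK (Lfun_Sub p1 fL)) => x /(_ I).
Qed.

Lemma L2_mul_integrable u v :
  mu.-integrable setT (EFin \o (fun x => Lspace_fun u x * Lspace_fun v x)).
Proof.
by apply/Lfun1_integrable; apply: Lfun2_mul_Lfun1; exact: Lspace_fun_Lfun.
Qed.

Lemma L2_innerC u v : L2_inner u v = L2_inner v u.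
Proof. by apply: eq_Rintegral => x _; rewrite mulrC. Qed.

(** The representative of [u + v] is the sum of the representatives only almost everywhere, so the
    integrands are compared by [ae_eq_integral]. *)
Lemma L2_innerDl u v w : L2_inner (u + v) w = L2_inner u w + L2_inner v w.
Proof.
rewrite /L2_inner -RintegralD//; try exact: L2_mul_integrable.
rewrite /Rintegral; congr fine; apply: ae_eq_integral => //.
- exact: measurable_int (L2_mul_integrable (u + v) w).
- apply/measurable_EFinP; apply: measurable_funD;
    apply: measurable_funM; exact: measurable_Lspace_fun.
- by apply: filterS (LspaceD u v) => x /(_ I) /= -> _; rewrite mulrDl.
Qed.

Lemma L2_innerZl (c : R) u v : L2_inner (c *: u) v = c * L2_inner u v.
Proof.
rewrite /L2_inner -RintegralZl//; last exact: L2_mul_integrable.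
rewrite /Rintegral; congr fine; apply: ae_eq_integral => //.
- exact: measurable_int (L2_mul_integrable (c *: u) v).
- apply/measurable_EFinP; apply: measurable_funM => //.
  by apply: measurable_funM; exact: measurable_Lspace_fun.
- by apply: filterS (LspaceZ c u) => x /(_ I) /= -> _; rewrite mulrA.
Qed.

Lemma L2_innerNl u v : L2_inner (- u) v = - L2_inner u v.
Proof. by rewrite -scaleN1r L2_innerZl mulN1r. Qed.

Lemma L2_norm_sqrD u v :
  `|u + v| ^+ 2 = `|u| ^+ 2 + 2 * L2_inner u v + `|v| ^+ 2.
Proof.
rewrite -!L2_inner_norm L2_innerDl ![L2_inner _ (u + v)]L2_innerC !L2_innerDl.
by rewrite (L2_innerC v u); ring.
Qed.

(** Test with [w = u - v]. An element of [L2] is thus determined by the functional it represents. *)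
Lemma L2_inner_nondegenerate u v :
  (forall w, L2_inner u w = L2_inner v w) -> u = v.
Proof.
move=> uv; apply/eqP; rewrite -subr_eq0 -normr_eq0 -sqrf_eq0.
by rewrite -L2_inner_norm L2_innerDl L2_innerNl uv subrr.
Qed.

End L2.

(** Division by [t] leaves [0 <= D + t * E] for arbitrarily small [t]. This extracts a first-order
    condition from minimality along a segment. *)
Lemma nonneg_linear_coef (R : realType) (D E : R) :
  (forall t : R, 0 < t -> t <= 1 -> 0 <= t * D + t ^+ 2 * E) -> 0 <= D.
Proof.
move=> h; rewrite leNgt; apply/negP => D0.
have E0 : 0 < `|E| + 1 by rewrite ltr_wpDl.
(* If [D < 0], any [t <= s] gives [t * E <= - D / 2], so [D + t * E < 0]. The [+ 1] covers
   [E = 0]. *)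
pose s := - D / (2 * (`|E| + 1)); pose t := Num.min 1 s.
have s0 : 0 < s by rewrite divr_gt0 ?oppr_gt0// mulr_gt0.
have t0 : 0 < t by rewrite lt_min ltr01.
have t1 : t <= 1 by rewrite ge_min lexx.
have ts : t <= s by rewrite ge_min lexx orbT.
have := h t t0 t1; rewrite expr2 -mulrA -mulrDr pmulr_rge0//.
apply/negP; rewrite -ltNge.
have tE : t * E <= s * (`|E| + 1).
  apply: le_trans (_ : t * (`|E| + 1) <= _); last by rewrite ler_wpM2r// ltW.
  by rewrite ler_wpM2l ?ltW// (le_lt_trans (ler_norm E))// ltrDl.
have sE : s * (`|E| + 1) = - D / 2 by rewrite /s; field; rewrite gt_eqF.
lra.
Qed.

(** * The variational inequality of the control problem *)

Section inner_product.
Context {R : realType} {H : normedModType R} {inner : {dot H for idfun}}.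
Hypothesis inner_norm : forall h : H, inner h h = `|h| ^+ 2.

Lemma innerC (h k : H) : inner h k = inner k h.
Proof. by have := hermC inner h k; rewrite expr0 mul1r. Qed.

Lemma innerZl (c : R) (h k : H) : inner (c *: h) k = c * inner h k.
Proof. exact: linearZl_LR. Qed.

Lemma norm_sqrD (h k : H) :
  `|h + k| ^+ 2 = `|h| ^+ 2 + 2 * inner h k + `|k| ^+ 2.
Proof.
by rewrite -!inner_norm linearDl /= !linearDr /= (innerC k h); ring.
Qed.

(* Polarization reduces the continuity of the form to that of the norm. *)
Lemma continuous_inner (k : H) : continuous (fun h => inner h k : R^o).
Proof.
have -> : (fun h => inner h k : R^o) =
    (fun h => 2^-1 * (`|h + k| ^+ 2 - `|h| ^+ 2 - `|k| ^+ 2)).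
  by apply/funext => h; rewrite norm_sqrD; field.
move=> h; apply: cvgM; first exact: cvg_cst.
apply: cvgB; last exact: cvg_cst.
have cn2 (g : H -> H) : {for h, continuous g} ->
    (fun x => `|g x| ^+ 2) @ h --> `|g h| ^+ 2.
  move=> cg; rewrite expr2; under eq_fun do rewrite expr2.
  by apply: cvgM; apply: cvg_norm; exact: cg.
apply: cvgB; last exact: (cn2 id).
by apply: (cn2 (fun x => x + k)); apply: cvgD; [exact: cvg_id|exact: cvg_cst].
Qed.

Section variational_inequality.
Context {d : measure_display} {X : measurableType d}.
Context {mu : {measure set X -> \bar R}}.
Variables (T : {linear LspaceType2 mu -> H}) (z : H).
Variables (a b : LspaceType mu (leey 1)) (alpha : R) (u : LspaceType2 mu).
Hypothesis u_sol : is_solution T z a b alpha u.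

Lemma U_ad_segment (v : LspaceType2 mu) (t : R) : 0 <= t -> t <= 1 ->
  U_ad a b v -> U_ad a b (u + t *: (v - u)).
Proof.
move=> t0 t1 vab; have [uab _] := u_sol.
have H1 : \forall x \ae mu, Lspace_fun (u + t *: (v - u)) x =
    Lspace_fun u x + t * (Lspace_fun v x - Lspace_fun u x).
  have H2 := ae_and _ _ (LspaceD u (t *: (v - u))) (LspaceZ t (v - u)).
  apply: filterS3 H2 (LspaceD v (- u)) (LspaceN u).
  by move=> x [/(_ I)-> /(_ I)/=->] /(_ I)/=-> /(_ I)/=->.
apply: filterS3 H1 uab vab => x -> /andP[au ub] /andP[av vb].
by apply/andP; split; nra.
Qed.

(** Moving from [u] to [u + t *: (v - u)] changes the cost by [t * D + t ^+ 2 * E], where [D] is the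
    expression claimed nonnegative; minimality of [u] makes this change nonnegative. *)
Lemma variational_inequality (v : LspaceType2 mu) : U_ad a b v ->
  0 <= inner (T (v - u)) (T u - z) + alpha * L2_inner u (v - u).
Proof.
move=> vab; have [_ u_min] := u_sol.
apply: (@nonneg_linear_coef _ _
  (2^-1 * `|T (v - u)| ^+ 2 + alpha / 2 * `|v - u| ^+ 2)) => t t0 t1.
have := u_min _ (U_ad_segment v t (ltW t0) t1 vab).
rewrite /cost linearD linearZ /= addrAC (norm_sqrD (T u - z)) L2_norm_sqrD.
rewrite (L2_innerC u (t *: _)) L2_innerZl (L2_innerC (v - u) u).
rewrite (innerC (T u - z)) innerZl !normrZ !exprMn !real_normK ?num_real//.
rewrite -subr_ge0.
move: (inner _ _ : R) (L2_inner _ _) `|T (v - u)| `|T u - z| `|u| `|v - u|.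
by move=> i1 i2 n1 n2 n3 n4; congr (_ <= _); field.
Qed.

End variational_inequality.
End inner_product.

(** * Pointwise consequences of the variational inequality *)

Section bang_bang.
Context {d : measure_display} {X : measurableType d} {R : realType}.
Context {mu : {measure set X -> \bar R}}.
Hypothesis mu_fin : mu setT \is a fin_num.
Variables (a b : LspaceType mu (leey 1)) (u w : LspaceType2 mu).
Hypothesis uab : U_ad a b u.
Hypothesis vi : forall v, U_ad a b v -> 0 <= L2_inner w (v - u).

(* The inequality is tested with a single [v], equal to [a] where [w > 0], to
   [b] where [w < 0] and to [u] elsewhere: then [w (v - u) <= 0]. *)
Lemma vi_active_bounds : \forall x \ae mu,
  (0 < Lspace_fun w x -> Lspace_fun u x = Lspace_fun a x) /\
  (Lspace_fun w x < 0 -> Lspace_fun u x = Lspace_fun b x).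
Proof.
have mw := measurable_Lspace_fun _ _ w.
pose P := [set x | 0 < Lspace_fun w x]; pose N := [set x | Lspace_fun w x < 0].
have mP : measurable P.
  have -> : P = Lspace_fun w @^-1` `]0, +oo[%classic.
    by apply/seteqP; split => x; rewrite /P /= in_itv/= andbT.
  by rewrite -[X in measurable X]setTI; exact: mw.
have mN : measurable N.
  have -> : N = Lspace_fun w @^-1` `]-oo, 0[%classic.
    by apply/seteqP; split => x; rewrite /N /= in_itv.
  by rewrite -[X in measurable X]setTI; exact: mw.
(* On a finite measure space L^oo lies in L^2, so the bounds may enter an [L2] test function. *)
have L2_of_Linfty (f : LspaceType mu (leey 1)) : Lspace_fun f \in Lfun mu 2%:E.
  by apply: (Lfun_subset (lee1n 2) (leey 1) mu_fin (leey _));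
    exact: Lspace_fun_Lfun.
have [ga gaE] := Lspace_of_Lfun _ (lee1n 2) _ (L2_of_Linfty a).
have [gb gbE] := Lspace_of_Lfun _ (lee1n 2) _ (L2_of_Linfty b).
(* [ha] is [a - u] cut off to [P] and [hb] is [b - u] cut off to [N]; the test function is
   [v = u + (ha + hb)]. *)
have [ha haE] := Lspace_of_Lfun _ (lee1n 2) _
  (Lfun_indicM _ _ _ (ltr0n _ 2) mP (Lspace_fun_Lfun _ _ (ga - u))).
have [hb hbE] := Lspace_of_Lfun _ (lee1n 2) _
  (Lfun_indicM _ _ _ (ltr0n _ 2) mN (Lspace_fun_Lfun _ _ (gb - u))).
have hE : \forall x \ae mu, Lspace_fun (ha + hb) x =
    \1_P x * (Lspace_fun a x - Lspace_fun u x) +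
    \1_N x * (Lspace_fun b x - Lspace_fun u x).
  have H1 := ae_and _ _ haE (LspaceD ga (- u)).
  have H2 := ae_and _ _ hbE (LspaceD gb (- u)).
  have H3 := ae_and _ _ gaE gbE.
  have H4 := ae_and _ _ (LspaceD ha hb) (LspaceN u).
  have H12 := ae_and _ _ H1 H2.
  apply: filterS3 H12 H3 H4.
  move=> x [[h1 /(_ I) /= h2] [h3 /(_ I) /= h4]] [h5 h6].
  move=> [/(_ I) /= h7 /(_ I) /= h8].
  by rewrite h7 h1 h3 h2 h4 h5 h6 h8.
have PE x : \1_P x = (0 < Lspace_fun w x)%R%:R :> R.
  by rewrite indicE mem_setE.
have NE x : \1_N x = (Lspace_fun w x < 0)%R%:R :> R.
  by rewrite indicE mem_setE.
have vab : U_ad a b (u + (ha + hb)).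
  apply: filterS3 (LspaceD u (ha + hb)) hE uab.
  move=> x /(_ I) /= -> -> /andP[au ub].
  rewrite PE NE; case: (ltgtP (Lspace_fun w x) 0) => _ /=; lra.
have := vi _ vab; rewrite addrAC subrr add0r /L2_inner => intge0.
have wh0 := ae_eq0_le0_Rintegral _ (L2_mul_integrable w (ha + hb)) _ intge0.
have {}wh0 : \forall x \ae mu, Lspace_fun w x * Lspace_fun (ha + hb) x = 0.
  apply: wh0; apply: filterS2 hE uab => x -> /andP[au ub].
  rewrite PE NE; case: (ltgtP (Lspace_fun w x) 0) => [w0|w0|->] /=; nra.
(* Where [w] is nonzero the other factor vanishes; it is [a - u] on [P] and [b - u] on [N]. *)
apply: filterS2 hE wh0 => x -> /eqP; rewrite mulf_eq0 PE NE => wh0.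
split=> w0; move: wh0; rewrite w0 (lt_gtF w0) /= ?(gt_eqF w0) ?(lt_eqF w0) /=;
  by move=> /eqP; lra.
Qed.

End bang_bang.

(** * Adjoints, optimality conditions and the gap between two solutions *)

Section optimality.
Context {d : measure_display} {X : measurableType d} {R : realType}.
Context {mu : {measure set X -> \bar R}}.
Context {H : normedModType R} {inner : {dot H for idfun}}.
Hypothesis inner_norm : forall h : H, inner h h = `|h| ^+ 2.
Context {V : topologicalLmodType R}.
Variables (T : {linear LspaceType2 mu -> H}) (B : LspaceType2 mu -> V).
Variable S : {linear V -> H}.
Hypothesis S_cont : continuous S.
Hypothesis T_SB : forall u, T u = S (B u).
Variable Bstar : (V -> R^o) -> LspaceType2 mu.
Hypothesis Bstar_adj : is_L2_adjoint B Bstar.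

(** This is B^* S^* = T^*. [Bstar_adj] speaks of continuous linear functionals only, so S^* h is
    first packaged as one; its continuity is that of [S] followed by [inner _ h]. *)
Lemma L2_inner_adjoint (h : H) u :
  L2_inner (Bstar (dual_adjoint inner S h)) u = inner (T u) h.
Proof.
have phi_linear : linear (dual_adjoint inner S h : V -> R^o).
  by move=> c x y; rewrite /dual_adjoint linearP linearDl /= innerZl.
pose phi : {linear V -> R^o} := HB.pack (dual_adjoint inner S h)
  (GRing.isLinear.Build R V R^o _ (dual_adjoint inner S h) phi_linear).
rewrite (_ : dual_adjoint inner S h = phi) // Bstar_adj; last first.
  move=> x; apply: (@continuous_comp _ _ _ S (fun k => inner k h : R^o)).
    exact: S_cont.
  exact: (continuous_inner inner_norm).
by rewrite /phi /= /dual_adjoint T_SB.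
Qed.

(** [Bstar] is a bare function, known only through its inner products, so additivity on adjoint
    states is recovered from nondegeneracy. *)
Lemma Bstar_dual_adjointB (h k : H) :
  Bstar (dual_adjoint inner S h - dual_adjoint inner S k) =
  Bstar (dual_adjoint inner S h) - Bstar (dual_adjoint inner S k).
Proof.
have -> : dual_adjoint inner S h - dual_adjoint inner S k =
    dual_adjoint inner S (h - k).
  by apply/funext => v; rewrite /dual_adjoint linearBr.
apply: L2_inner_nondegenerate => w.
by rewrite L2_innerDl L2_innerNl !L2_inner_adjoint linearBr.
Qed.

Hypothesis mu_fin : mu setT \is a fin_num.
Variables (z : H) (a b : LspaceType mu (leey 1)).

(** The variational inequality reads [0 <= L2_inner w (v - u)] with [w = q + alpha *: u]. *)
Lemma solution_active_bounds (alpha : R) (u : LspaceType2 mu) :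
  is_solution T z a b alpha u ->
  let q := Bstar (dual_adjoint inner S (T u - z)) in
  \forall x \ae mu,
    (0 < Lspace_fun q x + alpha * Lspace_fun u x ->
      Lspace_fun u x = Lspace_fun a x) /\
    (Lspace_fun q x + alpha * Lspace_fun u x < 0 ->
      Lspace_fun u x = Lspace_fun b x).
Proof.
move=> u_sol q.
have vi v : U_ad a b v -> 0 <= L2_inner (q + alpha *: u) (v - u).
  move=> vab; rewrite L2_innerDl L2_innerZl L2_inner_adjoint.
  exact: (variational_inequality inner_norm _ _ _ _ _ _ u_sol).
apply: filterS3 (LspaceD q (alpha *: u)) (LspaceZ alpha u)
  (vi_active_bounds mu_fin _ _ _ _ u_sol.1 vi).
by move=> x /(_ I) /= -> /(_ I) /= ->.
Qed.

Variable sigma : R.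
Hypothesis sigma_ab : \forall x \ae mu,
  Lspace_fun a x <= - sigma /\ sigma <= Lspace_fun b x.

Lemma solution_gap (alpha : R) (u0 u : LspaceType2 mu) :
  0 < sigma -> 0 < alpha ->
  is_solution T z a b 0 u0 -> is_solution T z a b alpha u ->
  let p0 := dual_adjoint inner S (T u0 - z) in
  let p := dual_adjoint inner S (T u - z) in
  \forall x \ae mu, Lspace_fun (Bstar p0) x <> 0 ->
    `|Lspace_fun (Bstar p0) x| <= alpha * sigma / 4 ->
    `|Lspace_fun (Bstar (p - p0)) x| <= alpha * sigma / 4 ->
    sigma / 2 <= `|Lspace_fun (u - u0) x|.
Proof.
move=> sigma0 alpha0 u0_sol u_sol p0 p; rewrite Bstar_dual_adjointB.
have H1 := ae_and _ _
  (solution_active_bounds _ _ u0_sol) (solution_active_bounds _ _ u_sol).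
have H2 := ae_and _ _
  (LspaceD (Bstar p) (- Bstar p0)) (LspaceN (Bstar p0)).
have H3 := ae_and _ _
  (LspaceD u (- u0)) (LspaceN u0).
have H23 := ae_and _ _ H2 H3.
apply: filterS3 H1 H23 sigma_ab => x.
move=> [[] + + [] + +] [[/(_ I) /= -> /(_ I) /= ->] [/(_ I) /= -> /(_ I) /= ->]].
rewrite -/p -/p0 mul0r addr0.
move: (Lspace_fun a x) (Lspace_fun b x) (Lspace_fun (Bstar p0) x)
  (Lspace_fun (Bstar p) x) (Lspace_fun u x) (Lspace_fun u0 x).
move=> ax bx q0 q ux u0x u0a u0b ua ub [asigma bsigma] q00.
rewrite !ler_norml => /andP[q0l q0u] /andP[qdl qdu].
(* The two smallness bounds give [|q| <= alpha * sigma / 2]. If [ux > sigma / 2], then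
   [q + alpha * ux > 0] and [ux = ax <= - sigma], a contradiction; the lower bound is symmetric. *)
have uh : - (sigma / 2) <= ux <= sigma / 2.
  apply/andP; split; rewrite leNgt; apply/negP => uxs.
    have /ub : q + alpha * ux < 0 by nra.
    by lra.
  have /ua : 0 < q + alpha * ux by nra.
  by lra.
(* The sign of [q0] puts [u0x] at [bx >= sigma] or at [ax <= - sigma], at distance at least
   [sigma / 2] from [ux]. *)
have [q0_lt0|q0_gt0|//] := ltgtP q0 0.
  by rewrite ler0_norm; have := u0b q0_lt0; lra.
by rewrite ger0_norm; have := u0a q0_gt0; lra.
Qed.

End optimality.

(** * Restricted measures, Chebyshev's inequality and bounded sets *)

Section restriction.
Context {d : measure_display} {X : measurableType d} {R : realType}.
Variable mu : {measure set X -> \bar R}.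

(** A null set for the larger domain meets the smaller one in a null set. This carries optimality
    conditions on Omega over to [A], where the rates are given. *)
Lemma ae_mrestrS (D A : set X) (mD : measurable D) (mA : measurable A)
  (P : X -> Prop) : A `<=` D ->
  (\forall x \ae mrestr mu mD, P x) -> \forall x \ae mrestr mu mA, P x.
Proof.
move=> AD [N [mN N0 PN]]; exists N; split => //.
apply/eqP; rewrite eq_le measure_ge0 andbT -N0.
by apply: le_measure; rewrite ?inE; [exact: measurableI..|exact: setIS].
Qed.

(** Chebyshev's inequality: integrate [c ^ p <= |g| ^ p] over [E], then enlarge the domain of
    integration. *)
Lemma powR_measure_le_Lnorm (E : set X) (g : X -> R) (c p : R) : measurable E ->
  measurable_fun setT g -> 0 <= c -> 0 < p ->
  (\forall x \ae mu, E x -> c <= `|g x|) ->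
  ((c `^ p)%:E * mu E <= 'N[mu]_p%:E[EFin \o g] `^ p)%E.
Proof.
move=> mE mg c0 p0 cg; rewrite poweR_Lnorm ?gt_eqF//.
have mgp : measurable_fun setT (fun x => (`|g x| `^ p)%:E).
  apply/measurable_EFinP.
  by apply: (measurableT_comp (measurable_powR _)); exact: measurableT_comp.
rewrite -integral_cst//.
apply: (@le_trans _ _ (\int[mu]_(x in E) (`|g x| `^ p)%:E)%E); last first.
  by apply: ge0_subset_integral => // x _; rewrite lee_fin powR_ge0.
apply: ae_ge0_le_integral => //.
- by move=> x _; rewrite lee_fin powR_ge0.
- exact: measurable_funTS mgp.
- apply: filterS cg => x + Ex => /(_ Ex) cgx.
  by rewrite lee_fin ge0_ler_powR ?nnegrE// ltW.
Qed.

End restriction.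

(** The norm of ['rV[R]_n] is the maximum norm, so one cube covers [D] and its volume bounds the
    outer measure. *)
Lemma lebesgue_Rn_bounded (R : realType) (n : nat) (D : set (Rn R n)) :
  bounded_set (D : set 'rV[R]_n) -> exists M : R, 0 <= M /\
  (lebesgue_Rn R n D <= M%:E)%E.
Proof.
move=> [M0 [_ /(_ (M0 + 1))]]; rewrite ltrDl ltr01 => /(_ isT) DM.
pose I : 'rV[R]_n * 'rV[R]_n := (const_mx (- (M0 + 1)), const_mx (M0 + 1)).
exists (box_volume I); split; first by rewrite -lee_fin box_volume_ge0.
apply: ereal_inf_lbound; exists [set I].
  split; first exact: countable1.
  move=> x /DM xM; exists I => // i; rewrite !mxE -ler_norml.
  apply: le_trans xM.
  by rewrite [leRHS]/Num.norm /= mx_normrE; apply: le_bigmax (ord0, i).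
by rewrite esum_set1// box_volume_ge0.
Qed.

(** Beyond [e0] the crude bound [M] is at most [M / e0 ^ kappa * e ^ kappa]; adding this constant to
    [K] serves both ranges. *)
Lemma rate_constant (R : realType) (m : R -> \bar R) (M K e0 kappa : R) :
  0 <= M -> 0 <= K -> 0 < e0 -> 0 < kappa ->
  (forall e, (m e <= M%:E)%E) ->
  (forall e, 0 < e -> e <= e0 -> (m e <= (K * e `^ kappa)%:E)%E) ->
  exists C : R, 0 <= C /\ forall e, 0 < e -> (m e <= (C * e `^ kappa)%:E)%E.
Proof.
move=> M0 K0 e00 kappa0 mM mK; have e0k : 0 < e0 `^ kappa by exact: powR_gt0.
exists (K + M / e0 `^ kappa); split.
  by rewrite addr_ge0// divr_ge0// ltW.
move=> e e_gt0; have [ee0|e0e] := leP e e0.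
  apply: le_trans (mK _ e_gt0 ee0) _; rewrite lee_fin ler_wpM2r ?powR_ge0//.
  by rewrite lerDl divr_ge0// ltW.
apply: le_trans (mM e) _; rewrite lee_fin.
apply: (@le_trans _ _ (M / e0 `^ kappa * e `^ kappa)); last first.
  by rewrite ler_wpM2r ?powR_ge0// lerDr.
rewrite mulrAC ler_pdivlMr// ler_wpM2l// ge0_ler_powR ?nnegrE//; exact: ltW.
Qed.

(** * The measure estimate on [A] from the convergence rates *)

Theorem theorem13
  (R : realType) (n : nat) (n_ge1 : (1 <= n)%N)
  (Omega : set (Rn R n)) (mOmega : measurable Omega)
  (bOmega : bounded_set (Omega : set 'rV[R]_n))
  (H : completeNormedModType R) (inner : {dot H for idfun})
  (inner_norm : forall h : H, inner h h = `|h| ^+ 2)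
  (V : topologicalLmodType R)
  (T : {linear L2 mOmega -> H}) (B : {linear L2 mOmega -> V})
  (S : {linear V -> H})
  (T_cont : continuous T) (B_cont : continuous B) (S_cont : continuous S)
  (T_SB : forall u : L2 mOmega, T u = S (B u))
  (Bstar : (V -> R^o) -> L2 mOmega) (Bstar_adj : is_L2_adjoint B Bstar)
  (z : H) (a b : Linfty mOmega)
  (a_le_b : \forall x \ae lebesgue_on mOmega, Lspace_fun a x <= Lspace_fun b x)
  (ubar : R -> L2 mOmega)
  (ubar_sol : forall alpha : R, 0 <= alpha ->
    is_solution T z a b alpha (ubar alpha)) :
  let pbar (alpha : R) : V -> R^o := dual_adjoint inner S (T (ubar alpha) - z) in
  forall (A : set (Rn R n)) (mA : measurable A),
  A `<=` Omega ->
  (\forall x \ae lebesgue_on mOmega,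
     Omega x -> Lspace_fun (Bstar (pbar 0)) x = 0 -> (Omega `\` A) x) ->
  (exists sigma : R, 0 < sigma /\
     \forall x \ae lebesgue_on mOmega,
       Lspace_fun a x <= - sigma /\ sigma <= Lspace_fun b x) ->
  forall kappa : R, 1 < kappa ->
  (exists p C : R, 1 <= p /\
     forall alpha : R, 0 < alpha ->
       ('N[lebesgue_on mA]_p%:E[EFin \o Lspace_fun (ubar alpha - ubar 0)%R] `^ p
        + 'N[lebesgue_on mA]_+oo[EFin \o Lspace_fun (Bstar (pbar alpha - pbar 0)%R)]
        <= (C * alpha `^ kappa)%:E)%E) ->
  exists C' : R, 0 <= C' /\
    forall eps : R, 0 < eps ->
      (lebesgue_Rn R n
         (A `&` [set x | (0 <= `|Lspace_fun (Bstar (pbar 0%R)) x| <= eps)%R])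
       <= (C' * eps `^ kappa)%:E)%E.
Proof.
move=> pbar A mA AO p0_neq0 [sigma [sigma0 sigma_ab]] kappa kappa1.
move=> [p [C [p1 rate]]].
have kappa0 : 0 < kappa by exact: lt_trans ltr01 kappa1.
have p_gt0 : 0 < p by exact: lt_le_trans ltr01 p1.
have [M [M0 OM]] := lebesgue_Rn_bounded _ _ _ bOmega.
have mu_fin : lebesgue_on mOmega setT \is a fin_num.
  by rewrite ge0_fin_numE// /mrestr setTI (le_lt_trans OM)// ltry.
set q0 := Lspace_fun (Bstar (pbar 0)) in p0_neq0 *.
pose E (eps : R) : set (Rn R n) := A `&` [set x | (0 <= `|q0 x| <= eps)%R].
have mE (eps : R) : measurable (E eps).
  have -> : E eps = A `&` (Num.norm \o q0) @^-1` `[0, eps]%classic.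
    by apply/seteqP; split=> x [Ax] /=; rewrite in_itv.
  apply: measurableI => //; rewrite -[X in measurable X]setTI.
  have : measurable_fun setT (Num.norm \o q0).
    by apply: measurableT_comp => //; exact: measurable_Lspace_fun.
  by apply.
(* At [alpha = 1] the rate bounds a nonnegative sum by [C]. *)
have C0 : 0 <= C.
  have := rate 1 ltr01; rewrite powR1 mulr1 -lee_fin.
  by apply: le_trans; apply: adde_ge0; [exact: poweR_ge0|exact: Lnorm_ge0].
have rate_u (alpha : R) : 0 < alpha ->
    ('N[lebesgue_on mA]_p%:E[EFin \o Lspace_fun (ubar alpha - ubar 0)%R] `^ p
     <= (C * alpha `^ kappa)%:E)%E.
  by move=> /rate; apply: le_trans; apply: leeDl; exact: Lnorm_ge0.
have rate_p (alpha : R) : 0 < alpha -> \forall x \ae lebesgue_on mA,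
    `|Lspace_fun (Bstar (pbar alpha - pbar 0)) x| <= C * alpha `^ kappa.
  move=> /rate /(le_trans (leeDr _ (poweR_ge0 _ _))) /Linfty_norm_ae_le.
  by apply: filterS => x /=; rewrite lee_fin.
(* Solves [alpha0 ^ (kappa - 1) = sigma / (4 * (C + 1))], so that
   [C * alpha ^ kappa <= alpha * sigma / 4] up to [alpha0]; here [kappa > 1] enters. [C + 1] avoids
   a zero denominator. *)
pose alpha0 := (sigma / (4 * (C + 1))) `^ (kappa - 1)^-1.
have C1 : 0 < C + 1 by rewrite ltr_wpDl.
have base_gt0 : 0 < sigma / (4 * (C + 1)) by rewrite divr_gt0// mulr_gt0.
have alpha0_gt0 : 0 < alpha0 by exact: powR_gt0.
have small (alpha : R) : 0 < alpha -> alpha <= alpha0 ->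
    C * alpha `^ kappa <= alpha * sigma / 4.
  move=> a0 aa0; rewrite -(mulr_powRB1 (ltW a0) kappa0) mulrCA -mulrA ler_pM2l//.
  have : alpha `^ (kappa - 1) <= sigma / (4 * (C + 1)).
    have -> : sigma / (4 * (C + 1)) = alpha0 `^ (kappa - 1).
      by rewrite -powRrM mulVf ?powRr1 ?(ltW base_gt0)// subr_eq0 gt_eqF.
    by apply: ge0_ler_powR; rewrite ?nnegrE ?subr_ge0 ?(ltW kappa1)// ltW.
  move=> /(ler_wpM2l C0) /le_trans; apply.
  rewrite mulrCA ler_pM2l// ler_pdivrMr ?mulr_gt0//.
  by rewrite mulrA mulVf// mul1r lerDl.
(* The rate at [alpha = eps * (4 / sigma)], divided by the Chebyshev factor [(sigma / 2) ^ p]. *)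
pose K := C * (4 / sigma) `^ kappa / (sigma / 2) `^ p.
have s2p : 0 < (sigma / 2) `^ p by rewrite powR_gt0// divr_gt0.
apply: (rate_constant R (fun eps => lebesgue_Rn R n (E eps)) M K
  (alpha0 * sigma / 4) kappa) => //.
- by rewrite /K divr_ge0 ?mulr_ge0 ?powR_ge0.
- by rewrite divr_gt0// mulr_gt0.
- move=> eps; apply: le_trans OM; apply: le_measure; rewrite ?inE//.
  by move=> x [/AO].
move=> eps eps0 eps_le.
(* Chosen so that [eps] is exactly the threshold [alpha * sigma / 4] of [solution_gap]. *)
pose alpha := eps * (4 / sigma).
have alpha_gt0 : 0 < alpha by rewrite mulr_gt0// divr_gt0.
have alphaE : alpha * sigma / 4 = eps by rewrite /alpha; field; rewrite gt_eqF.
have alpha_le : alpha <= alpha0.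
  by rewrite -(ler_pM2r sigma0) -(@ler_pM2r _ 4^-1)// alphaE.
have gap := solution_gap inner_norm _ _ _ S_cont T_SB _ Bstar_adj mu_fin _ _ _ _
  sigma_ab alpha _ _ sigma0 alpha_gt0 (ubar_sol 0 (lexx _))
  (ubar_sol alpha (ltW alpha_gt0)).
have gapE : \forall x \ae lebesgue_on mA, E eps x ->
    sigma / 2 <= `|Lspace_fun (ubar alpha - ubar 0) x|.
  apply: filterS3 (ae_mrestrS _ _ _ mOmega mA _ AO gap)
    (ae_mrestrS _ _ _ mOmega mA _ AO p0_neq0) (rate_p _ alpha_gt0).
  move=> x gapx q0x rx [Ax /andP[_ q0eps]]; apply: gapx.
  (* A zero of B^*p_0 would lie outside [A]. *)
  - by move=> /(q0x (AO _ Ax)) [].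
  - by rewrite alphaE.
  - by apply: le_trans rx _; exact: small.
have s20 : 0 <= sigma / 2 by rewrite ltW// divr_gt0.
have := powR_measure_le_Lnorm (lebesgue_on mA) (E eps)
  (Lspace_fun (ubar alpha - ubar 0)) _ _ (mE eps) _ s20 p_gt0 gapE.
move=> /(_ (measurable_Lspace_fun _ _ _)) /le_trans /(_ (rate_u _ alpha_gt0)).
(* The restricted measure intersects with [A], which leaves [E eps] unchanged. *)
rewrite -[X in (_ * X <= _)%E -> _]/(lebesgue_Rn R n (E eps `&` A)).
rewrite (_ : E eps `&` A = E eps); last by rewrite /E setIAC setIid.
rewrite -lee_pdivlMl// => /le_trans; apply; rewrite -EFinM lee_fin.
rewrite /alpha (@powRM _ eps) ?(ltW eps0) ?divr_ge0 ?(ltW sigma0)// /K le_eqVlt.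
apply/orP; left.
by apply/eqP; field; rewrite gt_eqF.
Qed.
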